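(* Let $H\neq\{0\}$ be a complex Hilbert space with norm $|\cdot|$ and inner product $(\cdot\,|\,\cdot)$, and let $A$ be an accretive operator in $H$ with domain $D(A)$ such that $-A$ generates a uniformly bounded, holomorphic $C_0$-semigroup $e^{-tA}$ in $H$ (in the sense of the context: $A$ is densely defined and closed and satisfies, for some $\delta\in\,]0,\frac{\pi}{2}[$ and $C>0$, the stated resolvent estimate on $\{0\}\cup\Sigma_{\delta+\pi/2}$). For $u_0\in H$ put $h(t)=|e^{-tA}u_0|$, $t\ge0$. Suppose that (i) for every $u_0\in H$ with $u_0\neq0$ the function $h$ is log-convex on $[0,\infty[$, i.e. for all $0\le r<s<t$, $$h(s)\le h(r)^{\frac{t-s}{t-r}}\,h(t)^{\frac{s-r}{t-r}};$$ (ii) for every $u_0\in D(A)$ with $|u_0|=1$ the one-sided derivative $h'(0)=\lim_{t\to0^+}\frac{h(t)-h(0)}{t}$ exists and fulfils $h'(0)=-\operatorname{Re}(Au_0\,|\,u_0)$. Then $A$ is strictly accretive and $$m(A)=\underline{\sigma}(A)>0.$$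
   Context: For $\theta>0$ write $\Sigma_\theta=\{z\in\mathbb{C}\mid -\theta<\arg z<\theta\}$ (an open sector, $0\notin\Sigma_\theta$). Meaning of ''$-A$ generates a uniformly bounded, holomorphic $C_0$-semigroup'': $A$ is a densely defined, closed operator in $H$ for which there are $\delta\in\,]0,\frac{\pi}{2}[$ and $C>0$ such that for all $\lambda\in\{0\}\cup\Sigma_{\delta+\pi/2}$ the operator $A+\lambda I$ is a bijection $D(A)\to H$ with bounded inverse and $|\lambda|\,\|(A+\lambda I)^{-1}\|\le C$ (for $\lambda=0$ this just says that $0$ is in the resolvent set of $A$). Then $-A$ generates a $C_0$-semigroup $e^{-tA}$, $t\ge0$, in $\mathbb{B}(H)$, uniformly bounded ($\|e^{-tA}\|\le M$ for $t\ge 0$), which extends holomorphically to $\Sigma_\delta$. The numerical range of $A$ is $\nu(A)=\{(Ax\,|\,x)\mid x\in D(A),\ |x|=1\}$ and its lower bound is $m(A)=\inf\operatorname{Re}\nu(A)$. The operator $A$ is called accretive if $m(A)\ge0$ and strictly accretive if $m(A)>0$. The spectral abscissa of $A$ is $\underline{\sigma}(A)=\inf\operatorname{Re}\sigma(A)$, where $\sigma(A)$ is the spectrum of $A$. *)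

(* Defs.v *)
From HB Require Import structures.
From mathcomp Require Import all_boot all_order all_algebra.
From mathcomp Require Import complex.
From mathcomp Require Import all_classical all_reals all_analysis.

Set Implicit Arguments.
Unset Strict Implicit.
Unset Printing Implicit Defensive.
Import Order.TTheory GRing.Theory Num.Theory.
Import numFieldNormedType.Exports.

Local Open Scope classical_set_scope.
Local Open Scope ring_scope.
Local Open Scope complex_scope.

(* A complex Hilbert space is a complete normed space H over R[i] with a
   positive definite Hermitian form ip (linear in its first argument, conjugate
   linear in the second) satisfying [induces_norm ip]. *)
Definition induces_norm (R : realType) (H : normedModType R[i])
    (ip : {dot H for @Num.conj R[i]}) : Prop :=
  forall x : H, ip x x = `|x| ^+ 2.

(* The norm of a normedModType over R[i] takes its values in R[i], on the
   nonnegative real axis. *)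
Definition rnorm (R : realType) (H : normedModType R[i]) (x : H) : R :=
  complex.Re `|x|.

(* op_fun is meaningful only on op_dom. *)
Record operator (R : realType) (H : normedModType R[i]) := Operator {
  op_dom : set H ;
  op_fun :> H -> H ;
  op_dom0 : op_dom 0 ;
  op_domP : forall (a : R[i]) (x y : H),
    op_dom x -> op_dom y -> op_dom (a *: x + y) ;
  op_linear : forall (a : R[i]) (x y : H),
    op_dom x -> op_dom y -> op_fun (a *: x + y) = a *: op_fun x + op_fun y }.

Definition densely_defined (R : realType) (H : normedModType R[i])
    (A : operator H) : Prop :=
  dense (op_dom A).

Definition closed_operator (R : realType) (H : normedModType R[i])
    (A : operator H) : Prop :=
  closed [set p : H * H | op_dom A p.1 /\ p.2 = A p.1].

(* A + lambda I is a bijection from D(A) onto H with bounded inverse T. *)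
Definition is_resolvent (R : realType) (H : normedModType R[i])
    (A : operator H) (lambda : R[i]) (T : {linear H -> H}) : Prop :=
  [/\ continuous T,
      forall y : H, op_dom A (T y) /\ A (T y) + lambda *: T y = y &
      forall x : H, op_dom A x -> T (A x + lambda *: x) = x].

Definition resolvent_set (R : realType) (H : normedModType R[i])
    (A : operator H) : set R[i] :=
  [set z | exists T : {linear H -> H}, is_resolvent A (- z) T].

Definition spectrum (R : realType) (H : normedModType R[i])
    (A : operator H) : set R[i] :=
  ~` resolvent_set A.

Definition sector (R : realType) (theta : R) : set R[i] :=
  [set z | exists r phi : R,
    [/\ 0 < r, - theta < phi, phi < theta &
        z = (r * cos phi) +i* (r * sin phi)]].

(* The last inequality, for all y, is the operator norm estimate
   |lambda| ||(A + lambda I)^-1|| <= C. *)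
Definition sectorial (R : realType) (H : normedModType R[i])
    (A : operator H) : Prop :=
  [/\ densely_defined A,
      closed_operator A &
      exists delta C : R,
        [/\ 0 < delta, delta < pi / 2, 0 < C &
            forall lambda : R[i],
              lambda = 0 \/ sector (delta + pi / 2) lambda ->
              exists T : {linear H -> H}, is_resolvent A lambda T /\
                forall y : H, `|lambda| * `|T y| <= C%:C * `|y|]].

(* Only the values of S on [0, +oo[ are constrained. *)
Definition C0_semigroup (R : realType) (H : normedModType R[i])
    (S : R -> {linear H -> H}) : Prop :=
  [/\ forall t : R, 0 <= t -> continuous (S t),
      forall x : H, S 0 x = x,
      forall (s t : R) (x : H), 0 <= s -> 0 <= t -> S (s + t) x = S s (S t x) &
      forall x : H, S t x @[t --> 0^'+] --> x].

(* -A, with its domain D(A), is the infinitesimal generator of S. *)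
Definition generated_by_opp (R : realType) (H : normedModType R[i])
    (A : operator H) (S : R -> {linear H -> H}) : Prop :=
  forall x y : H,
    (op_dom A x /\ y = - A x) <->
    ((t^-1)%:C *: (S t x - x) @[t --> 0^'+] --> y).

(* S t = e^{-tA}. Uniform boundedness of S and its holomorphic extension to
   sector delta are consequences of [sectorial A]. *)
Definition generates_bounded_holomorphic (R : realType)
    (H : normedModType R[i]) (A : operator H) (S : R -> {linear H -> H}) : Prop :=
  [/\ sectorial A, C0_semigroup S & generated_by_opp A S].

(* In \bar R the infimum of the empty set is +oo. *)
Definition inf_Re (R : realType) (Z : set R[i]) : \bar R :=
  ereal_inf [set (complex.Re z)%:E | z in Z].

Definition numerical_range (R : realType) (H : normedModType R[i])
    (ip : {dot H for @Num.conj R[i]}) (A : operator H) : set R[i] :=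
  [set ip (A x) x | x in [set x | op_dom A x /\ `|x| = 1]].

Definition lower_bound (R : realType) (H : normedModType R[i])
    (ip : {dot H for @Num.conj R[i]}) (A : operator H) : \bar R :=
  inf_Re (numerical_range ip A).

Definition accretive (R : realType) (H : normedModType R[i])
    (ip : {dot H for @Num.conj R[i]}) (A : operator H) : Prop :=
  (0 <= lower_bound ip A)%E.

Definition strictly_accretive (R : realType) (H : normedModType R[i])
    (ip : {dot H for @Num.conj R[i]}) (A : operator H) : Prop :=
  (0 < lower_bound ip A)%E.

Definition spectral_abscissa (R : realType) (H : normedModType R[i])
    (A : operator H) : \bar R :=
  inf_Re (spectrum A).

Definition log_convex (R : realType) (h : R -> R) : Prop :=
  forall r s t : R, 0 <= r -> r < s -> s < t ->
    h s <= h r `^ ((t - s) / (t - r)) * h t `^ ((s - r) / (t - r)).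

(* Main.v *)
Require Import Defs.
From HB Require Import structures.
From mathcomp Require Import all_boot all_order all_algebra.
From mathcomp Require Import cyclic separable cyclotomic complex.
From mathcomp Require Import all_classical all_reals all_analysis.
From mathcomp Require Import ring lra.

Set Implicit Arguments.
Unset Strict Implicit.
Unset Printing Implicit Defensive.
Import Order.TTheory GRing.Theory Num.Theory.
Import numFieldNormedType.Exports.

Local Open Scope classical_set_scope.
Local Open Scope ring_scope.
Local Open Scope complex_scope.

(** The logarithmic derivative of [h] is minus the Rayleigh quotient
    [Re (Ax|x) / |x|^2] along the orbit, so log-convexity says that this
    quotient decreases; at [t = 0] this amounts to
    [2 (Re (Ax|x))^2 <= (Re (A^2 x|x) + |Ax|^2) |x|^2].
    Write [m = m(A)], [B = A - m] and [q x = Re (Bx|x) >= 0].  The inequality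
    implies that [q] does not increase under the backward Euler step
    [V = (I + s B)^-1].

    The half-plane [Re z < m] is in the resolvent set, so [m <= sigma(A)], and
    sectoriality gives [sigma(A) > 0].  Suppose [m < sigma(A)].  Then
    [|z + 1| |x| <= C |(B + z) x|] for [Re z >= 0].  Fix [u] in the domain and
    put [v_k = V^k u], [s = T / n].  Since [q] does not increase, [|v_k|^2]
    stays close to [|u|^2] for [k <= n] when [q u] and [s] are small.  On the
    other hand, for [w^n = 1] the vector [y = \sum_(k < n) w^k v_(k+1)] solves
    [s B y + (1 - w) y = u - v_n], hence [|1 + s - w| |y| <= 2 C |u|], and
    Parseval over the [n]-th roots of unity bounds [s \sum_k |v_k|^2]
    independently of [n].  For [T] large this forces [q u >= c |u|^2] with
    [c > 0], contradicting the definition of [m]. *)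

(** * Modulus, norm and real inner product *)

Section Modulus.
Context {R : realType}.
Implicit Types a b : R[i].

(** The norm of [R[i]] takes values in [R[i]]; its real part makes moduli available to order
    arguments in [R]. *)
Definition cabs a : R := complex.Re `|a|.

Lemma cabsE a : `|a| = (cabs a)%:C.
Proof. exact: (esym (RRe_real (normr_real a))). Qed.

Lemma cabs_ge0 a : 0 <= cabs a.
Proof. by rewrite -lecR -cabsE; exact: normr_ge0. Qed.

Lemma cabsM a b : cabs (a * b) = cabs a * cabs b.
Proof. by apply: complexI; rewrite rmorphM /= -!cabsE normrM. Qed.

Lemma cabsX a n : cabs (a ^+ n) = cabs a ^+ n.
Proof. by apply: complexI; rewrite rmorphXn /= -!cabsE normrX. Qed.

Lemma cabsV a : cabs a^-1 = (cabs a)^-1.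
Proof. by apply: complexI; rewrite fmorphV /= -!cabsE normfV. Qed.

Lemma cabs_eq0 a : (cabs a == 0) = (a == 0).
Proof. by rewrite -[RHS]normr_eq0 cabsE fmorph_eq0. Qed.

Lemma cabs_real (r : R) : cabs r%:C = `|r|.
Proof. by rewrite /cabs normc_def /= expr0n /= addr0 sqrtr_sqr. Qed.

Lemma cabs_sqr a : cabs a ^+ 2 = complex.Re a ^+ 2 + complex.Im a ^+ 2.
Proof.
by rewrite /cabs normc_def /= sqr_sqrtr // addr_ge0 ?sqr_ge0.
Qed.

Lemma Re_le_cabs a : `|complex.Re a| <= cabs a.
Proof.
by rewrite -(ler_pXn2r (n := 2)) ?nnegrE ?cabs_ge0 // cabs_sqr
  real_normK ?num_real // lerDl sqr_ge0.
Qed.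

Lemma Im_le_cabs a : `|complex.Im a| <= cabs a.
Proof.
by rewrite -(ler_pXn2r (n := 2)) ?nnegrE ?cabs_ge0 // cabs_sqr
  real_normK ?num_real // lerDr sqr_ge0.
Qed.

Lemma cabs_le a : cabs a <= `|complex.Re a| + `|complex.Im a|.
Proof.
rewrite -(ler_pXn2r (n := 2)) ?nnegrE ?cabs_ge0 ?addr_ge0 // cabs_sqr.
rewrite sqrrD !real_normK ?num_real // -addrA lerD2l lerDr.
by rewrite mulrn_wge0 // mulr_ge0.
Qed.

End Modulus.

Section RealNorm.
Context {R : realType} {H : normedModType R[i]}.
Implicit Types x y : H.

Lemma normHE x : `|x| = (rnorm x)%:C.
Proof. exact: (esym (RRe_real (normr_real x))). Qed.

Lemma rnorm_ge0 x : 0 <= rnorm x.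
Proof. by rewrite -lecR -normHE; exact: normr_ge0. Qed.

Lemma rnormD x y : rnorm (x + y) <= rnorm x + rnorm y.
Proof. by rewrite -lecR rmorphD /= -!normHE ler_normD. Qed.

Lemma rnormN x : rnorm (- x) = rnorm x.
Proof. by rewrite /rnorm normrN. Qed.

Lemma rnormB x y : rnorm (x - y) <= rnorm x + rnorm y.
Proof. by rewrite -(rnormN y) rnormD. Qed.

Lemma rnormZ (a : R[i]) x : rnorm (a *: x) = cabs a * rnorm x.
Proof. by apply: complexI; rewrite rmorphM /= -normHE -cabsE -normHE normrZ. Qed.

Lemma rnorm_eq0 x : (rnorm x == 0) = (x == 0).
Proof. by rewrite -[RHS]normr_eq0 normHE fmorph_eq0. Qed.

Lemma rnorm0 : rnorm (0 : H) = 0.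
Proof. by apply/eqP; rewrite rnorm_eq0. Qed.

Lemma rnorm_gt0 x : (0 < rnorm x) = (x != 0).
Proof. by rewrite lt_def rnorm_eq0 rnorm_ge0 andbT. Qed.

End RealNorm.

Section RealInner.
Context {R : realType} {H : normedModType R[i]}.
Context {ip : {dot H for @Num.conj R[i]}}.
Hypothesis ipn : induces_norm ip.
Implicit Types x y : H.

(** The real part of a Hermitian form is a symmetric real bilinear form, so the energy estimates
    below become polynomial inequalities over [R]. *)
Definition rip x y : R := complex.Re (ip x y).

Lemma ripDl x y z : rip (x + y) z = rip x z + rip y z.
Proof. by rewrite /rip linearDl raddfD. Qed.

Lemma ripDr x y z : rip x (y + z) = rip x y + rip x z.
Proof. by rewrite /rip linearDr raddfD. Qed.

Lemma ripZl (a : R) x y : rip (a%:C *: x) y = a * rip x y.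
Proof. by rewrite /rip linearZl_LR /=; case: (ip x y) => u v /=; ring. Qed.

Lemma ripC x y : rip x y = rip y x.
Proof.
rewrite /rip hermC expr0 mul1r.
change (complex.Re (conjc (ip y x)) = complex.Re (ip y x)).
by case: (ip y x).
Qed.

Lemma ripZr (a : R) x y : rip x (a%:C *: y) = a * rip x y.
Proof. by rewrite ripC ripZl ripC. Qed.

Lemma ripNl x y : rip (- x) y = - rip x y.
Proof. by rewrite /rip linearNl raddfN. Qed.

Lemma ripNr x y : rip x (- y) = - rip x y.
Proof. by rewrite ripC ripNl ripC. Qed.

Lemma rip_sqr x : rip x x = rnorm x ^+ 2.
Proof. by rewrite /rip ipn normHE -rmorphXn. Qed.

Lemma rip0l y : rip 0 y = 0.
Proof. by rewrite /rip linear0l. Qed.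

(** Cauchy-Schwarz: expand the square of the norm of [|y| x - |x| y] and divide by [|x| |y|]. *)
Lemma rip_le x y : `|rip x y| <= rnorm x * rnorm y.
Proof.
wlog suff le : x y / rip x y <= rnorm x * rnorm y.
  by rewrite ler_norml le // andbT lerNl -ripNl -(rnormN x) le.
have [x0|x0] := eqVneq x 0; first by rewrite x0 rip0l mulr_ge0 ?rnorm_ge0.
have [y0|y0] := eqVneq y 0; first by rewrite y0 ripC rip0l mulr_ge0 ?rnorm_ge0.
have := sqr_ge0 (rnorm ((rnorm y)%:C *: x - (rnorm x)%:C *: y)).
rewrite -rip_sqr !(ripDl, ripDr, ripNl, ripNr, ripZl, ripZr) !rip_sqr (ripC y x).
have px : 0 < rnorm x by rewrite rnorm_gt0.
have py : 0 < rnorm y by rewrite rnorm_gt0.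
move=> h; rewrite -subr_ge0 -(pmulr_rge0 _ (mulr_gt0 px py)).
by nra.
Qed.

Lemma rnormD_sqr x y :
  rnorm (x + y) ^+ 2 = rnorm x ^+ 2 + 2 * rip x y + rnorm y ^+ 2.
Proof. by rewrite -rip_sqr !(ripDl, ripDr) (ripC y x) !rip_sqr; ring. Qed.

End RealInner.

Arguments rip {R H} ip x y.

(** * Parseval's identity over the roots of unity *)

(** [X^n - 1] splits and, in characteristic zero, is separable; its [n] distinct roots form a cyclic
    group. *)
Lemma exists_prim_root (C : numClosedFieldType) n :
  (0 < n)%N -> exists z : C, n.-primitive_root z.
Proof.
move=> n0; have [r] := closed_field_poly_normal ('X^n - 1 : {poly C}).
rewrite (monicP (monicXnsubC 1 n0)) scale1r => rP.
have rU : all n.-unity_root r.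
  by apply/allP => z; rewrite -root_prod_XsubC -rP.
have rn : (n <= size r)%N by rewrite -ltnS -(size_prod_XsubC r id) -rP size_XnsubC.
have ru : uniq r.
  by rewrite -separable_prod_XsubC -rP separable_Xn_sub_1 // pnatr_eq0 -lt0n.
by have /hasP[z _ zn] := has_prim_root n0 rU ru rn; exists z.
Qed.

(** Orthogonality of characters: the summand is [w ^+ j] with [w = z ^+ k / z ^+ l]. For [k != l]
    one has [w != 1] and [w ^+ n = 1], so the geometric sum vanishes. *)
Lemma sum_prim_root (C : numClosedFieldType) (z : C) n (k l : 'I_n) :
  n.-primitive_root z ->
  \sum_(j < n) (z ^+ j) ^+ k * Num.conj ((z ^+ j) ^+ l) = (n * (k == l))%:R.
Proof.
move=> zn; have n0 := prim_order_gt0 zn.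
have z0 : z != 0.
  apply: contraTneq (oner_neq0 C) => z0.
  by rewrite -(prim_expr_order zn) z0 expr0n gtn_eqF // eqxx.
have z1 : `|z| = 1.
  apply/eqP; rewrite -(@pexpr_eq1 _ _ n) // ?normr_ge0 //.
  by rewrite -normrX (prim_expr_order zn) normr1.
have zc : Num.conj z = z^-1 by rewrite invC_norm z1 expr1n invr1 mul1r.
pose w := z ^+ k / z ^+ l.
have wE j : (z ^+ j) ^+ k * Num.conj ((z ^+ j) ^+ l) = w ^+ j.
  rewrite !rmorphXn /= zc /w exprMn !exprVn -!exprM.
  by rewrite (mulnC k) (mulnC l).
under eq_bigr do rewrite wE.
have [kl|kl] := eqVneq k l.
  rewrite /w kl divff ?expf_neq0 //.
  by under eq_bigr do rewrite expr1n; rewrite sumr_const card_ord muln1.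
have w1 : w - 1 != 0.
  rewrite subr_eq0; apply: contra kl => /eqP w1; apply/eqP/val_inj => /=.
  have : z ^+ k == z ^+ l by rewrite -[z ^+ k](divfK (expf_neq0 l z0)) -/w w1 mul1r.
  by rewrite (eq_prim_root_expr zn) !modn_small // => /eqP.
apply/eqP; rewrite muln0 -(mulrI_eq0 _ (mulfI w1)) -subrX1.
rewrite /w exprMn exprVn -!exprM mulnC exprM (prim_expr_order zn) expr1n.
by rewrite mulnC exprM (prim_expr_order zn) expr1n divr1 subrr.
Qed.

Section Parseval.
Context {R : realType} {H : normedModType R[i]}.
Context {ip : {dot H for @Num.conj R[i]}}.
Hypothesis ipn : induces_norm ip.

Lemma parseval (z : R[i]) n (v : nat -> H) : n.-primitive_root z ->
  \sum_(j < n) rnorm (\sum_(k < n) (z ^+ j) ^+ k *: v k) ^+ 2 =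
  n%:R * \sum_(k < n) rnorm (v k) ^+ 2.
Proof.
move=> zn; apply: complexI; rewrite rmorphM !rmorph_sum rmorph_nat /=.
under eq_bigr do rewrite rmorphXn /= -normHE -ipn.
under [in RHS]eq_bigr do rewrite rmorphXn /= -normHE -ipn.
rewrite (eq_bigr (fun j : 'I_n => \sum_(k < n) \sum_(l < n)
   (z ^+ j) ^+ k * Num.conj ((z ^+ j) ^+ l) * ip (v k) (v l))); last first.
  move=> j _; rewrite linear_sumlz; apply: eq_bigr => k _.
  rewrite linear_sumr; apply: eq_bigr => l _.
  by rewrite linearZl_LR linearZr_LR mulrA.
rewrite exchange_big mulr_sumr; apply: eq_bigr => k _.
rewrite exchange_big (bigD1 k) //= [X in _ + X]big1 ?addr0 => [|l lk].
  by rewrite -mulr_suml sum_prim_root // eqxx muln1.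
by rewrite -mulr_suml sum_prim_root // eq_sym (negPf lk) muln0 mul0r.
Qed.

End Parseval.

(** * Backward Euler iteration *)

Section Operator.
Context {R : realType} {H : normedModType R[i]}.
Variable A : operator H.
Implicit Types x y : H.

Lemma op_domZ (a : R[i]) x : op_dom A x -> op_dom A (a *: x).
Proof. by move=> Dx; rewrite -[_ *: _]addr0; apply: op_domP (op_dom0 A). Qed.

Lemma op_domD x y : op_dom A x -> op_dom A y -> op_dom A (x + y).
Proof. by move=> Dx Dy; rewrite -[x]scale1r; apply: op_domP. Qed.

Lemma op_domN x : op_dom A x -> op_dom A (- x).
Proof. by move=> Dx; rewrite -scaleN1r; exact: op_domZ. Qed.

Lemma op_domB x y : op_dom A x -> op_dom A y -> op_dom A (x - y).
Proof. by move=> Dx Dy; apply/op_domD/op_domN. Qed.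

Lemma opD x y : op_dom A x -> op_dom A y -> A (x + y) = A x + A y.
Proof. by move=> Dx Dy; rewrite -[x in LHS]scale1r op_linear // scale1r. Qed.

Lemma op0 : A 0 = 0.
Proof.
by apply: (addrI (A 0)); rewrite -opD ?addr0 //; exact: op_dom0.
Qed.

Lemma opZ (a : R[i]) x : op_dom A x -> A (a *: x) = a *: A x.
Proof.
by move=> Dx; rewrite -[_ *: x]addr0 op_linear ?op0 ?addr0 //; exact: op_dom0.
Qed.

Lemma opN x : op_dom A x -> A (- x) = - A x.
Proof. by move=> Dx; rewrite -scaleN1r opZ // scaleN1r. Qed.

Lemma opB x y : op_dom A x -> op_dom A y -> A (x - y) = A x - A y.
Proof. by move=> Dx Dy; rewrite opD ?opN //; exact: op_domN. Qed.

Lemma op_sum n (f : nat -> H) : (forall k, op_dom A (f k)) ->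
  op_dom A (\sum_(k < n) f k) /\ A (\sum_(k < n) f k) = \sum_(k < n) A (f k).
Proof.
move=> Df; elim: n => [|n [Ds As]].
  by rewrite !big_ord0 op0; split=> //; exact: op_dom0.
rewrite !big_ord_recr /=; split; first exact: op_domD.
by rewrite opD // As.
Qed.

Fact shift_operator_linear (m : R) (a : R[i]) x y : op_dom A x -> op_dom A y ->
  A (a *: x + y) - m%:C *: (a *: x + y) =
  a *: (A x - m%:C *: x) + (A y - m%:C *: y).
Proof.
move=> Dx Dy; rewrite op_linear // scalerDr scalerBr opprD addrACA.
by rewrite !scalerA mulrC.
Qed.

Definition shift_operator (m : R) : operator H :=
  @Operator R H (op_dom A) (fun x => A x - m%:C *: x) (op_dom0 A) (@op_domP R H A)
    (shift_operator_linear m).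

End Operator.

Section BackwardEuler.
Context {R : realType} {H : normedModType R[i]}.
Variables (ip : {dot H for @Num.conj R[i]}) (A : operator H).
Hypothesis ipn : induces_norm ip.
Hypothesis accA : forall x, op_dom A x -> 0 <= rip ip (A x) x.
Variables (s : R) (V : {linear H -> H}).
Hypotheses (s0 : 0 < s)
  (VP : forall x, op_dom A (V x) /\ V x + s%:C *: A (V x) = x)
  (Vq : forall u, op_dom A u -> rip ip (A (V u)) (V u) <= rip ip (A u) u).

Lemma euler_sqr x : rnorm (x + s%:C *: A x) ^+ 2 =
  rnorm x ^+ 2 + 2 * s * rip ip (A x) x + s ^+ 2 * rnorm (A x) ^+ 2.
Proof.
rewrite (rnormD_sqr ipn) ripZr ripC rnormZ cabs_real gtr0_norm //.
by rewrite exprMn mulrA.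
Qed.

Lemma euler_contraction x : rnorm (V x) <= rnorm x.
Proof.
have [Dx {2}<-] := VP x; rewrite -(ler_pXn2r (n := 2)) ?nnegrE ?rnorm_ge0 //.
rewrite euler_sqr -addrA lerDl addr_ge0 // mulr_ge0 ?sqr_ge0 //.
  by rewrite mulr_ge0 // ltW.
exact: accA.
Qed.

(** [VP] only makes [V] a right inverse of [I + s A]. It is also a left inverse because [I + s A] is
    injective: by accretivity all terms of [euler_sqr] are nonnegative. *)
Lemma eulerK x : op_dom A x -> V (x + s%:C *: A x) = x.
Proof.
move=> Dx; have [Dy yE] := VP (x + s%:C *: A x).
set y := V _ in Dy yE *; have Dxy : op_dom A (y - x) by exact: op_domB.
apply/eqP; rewrite -subr_eq0 -rnorm_eq0 -sqrf_eq0.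
have : rnorm (y - x + s%:C *: A (y - x)) ^+ 2 = 0.
  rewrite opB // scalerBr addrACA yE -opprD subrr rnorm0 expr0n //.
rewrite euler_sqr => /eqP; rewrite -addrA paddr_eq0 ?sqr_ge0 //; first by case/andP.
by rewrite addr_ge0 // mulr_ge0 ?sqr_ge0 ?accA // mulr_ge0 // ltW.
Qed.

(** With [y = V u], the identity [s A y = u - y] puts [A y] in the domain, and
    [A u = A y + s A (A y)] is sent to [A y] by [eulerK]. *)
Lemma euler_comm u : op_dom A u -> A (V u) = V (A u).
Proof.
move=> Du; have [Dy yE] := VP u; set y := V u in Dy yE *.
have sAy : s%:C *: A y = u - y by rewrite -[X in X - _]yE addrC addrA addNr add0r.
have DAy : op_dom A (A y).
  rewrite -[A y]scale1r -(mulVf (x := s%:C)); last by rewrite fmorph_eq0 gt_eqF.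
  by rewrite -scalerA sAy; exact/op_domZ/op_domB.
by rewrite -[in RHS]yE opD ?opZ ?eulerK //; exact: op_domZ.
Qed.

Lemma euler_iter u k : op_dom A u ->
  [/\ op_dom A (iter k V u), rnorm (A (iter k V u)) <= rnorm (A u),
      rip ip (A (iter k V u)) (iter k V u) <= rip ip (A u) u &
      rnorm (iter k V u) <= rnorm u].
Proof.
move=> Du; elim: k => [|k [Dk Ak qk nk]] /=; first by split.
split; first by have [] := VP (iter k V u).
- by rewrite euler_comm // (le_trans (euler_contraction _)).
- by rewrite (le_trans (Vq _)).
- by rewrite (le_trans (euler_contraction _)).
Qed.

(** By [euler_sqr], one step lowers the squared norm by exactly the bracket evaluated at the new
    iterate, and [euler_iter] bounds this loss by its value at [u]. *)
Lemma euler_lower u k : op_dom A u ->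
  rnorm u ^+ 2 - k%:R * (2 * s * rip ip (A u) u + s ^+ 2 * rnorm (A u) ^+ 2)
  <= rnorm (iter k V u) ^+ 2.
Proof.
move=> Du; elim: k => [|k IH]; first by rewrite mul0r subr0.
have [_ Ak qk _] := euler_iter k.+1 Du.
have [_ vE] := VP (iter k V u).
move: IH; rewrite -[X in _ <= rnorm X ^+ 2]vE euler_sqr -/(iter k.+1 V u).
have h1 : 2 * s * rip ip (A (iter k.+1 V u)) (iter k.+1 V u) <=
    2 * s * rip ip (A u) u by rewrite ler_wpM2l // mulr_ge0 // ltW.
have h2 : s ^+ 2 * rnorm (A (iter k.+1 V u)) ^+ 2 <= s ^+ 2 * rnorm (A u) ^+ 2.
  by rewrite ler_wpM2l ?sqr_ge0 // ler_pXn2r ?nnegrE ?rnorm_ge0.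
rewrite -natr1; lra.
Qed.

(** From [v_(k+1) + s A v_(k+1) = v_k], the [k]-th term of the left side is
    [w^k v_k - w^(k+1) v_(k+1)]. The sum telescopes, and [w^n = 1] removes the last weight. *)
Lemma euler_root u n (w : R[i]) : op_dom A u -> w ^+ n = 1 ->
  let y := \sum_(k < n) w ^+ k *: iter k.+1 V u in
  op_dom A y /\ s%:C *: A y + (1 - w) *: y = u - iter n V u.
Proof.
move=> Du wn /=.
have Dv k : op_dom A (w ^+ k *: iter k.+1 V u).
  by have [Dk _ _ _] := euler_iter k.+1 Du; exact: op_domZ.
have [Dy ->] := op_sum n Dv; split=> //.
rewrite !scaler_sumr -big_split /=.
pose f k := w ^+ k *: iter k V u.
rewrite (eq_bigr (fun k : 'I_n => - (f k.+1 - f k))).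
  rewrite sumrN -(big_mkord xpredT (fun k => f k.+1 - f k)).
  by rewrite telescope_sumr // opprB /f wn expr0 !scale1r.
move=> k _; have [Dk _ _ _] := euler_iter k.+1 Du.
have [_ vE] := VP (iter k V u).
rewrite /f -[iter k V u in RHS]vE -/(iter k.+1 V u).
rewrite opZ // !scalerA exprSr opprB scalerDr scalerA mulrBl mul1r.
by rewrite scalerBl (mulrC s%:C) (mulrC w) addrA (addrC (_ *: A _)).
Qed.

End BackwardEuler.

Lemma Bernoulli_exprn (R : realDomainType) (s : R) n :
  0 <= s -> 1 + n%:R * s <= (1 + s) ^+ n.
Proof.
move=> s0; elim: n => [|n IH]; first by rewrite mul0r addr0 expr0.
rewrite exprS; apply: le_trans (_ : (1 + s) * (1 + n%:R * s) <= _); last first.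
  by rewrite ler_wpM2l // addr_ge0.
have : 0 <= n%:R * s ^+ 2 by rewrite mulr_ge0 ?sqr_ge0.
rewrite -natr1; nra.
Qed.

(** * Coercivity from a resolvent bound on the right half-plane *)

Section Core.
Context {R : realType} {H : normedModType R[i]}.
Variables (ip : {dot H for @Num.conj R[i]}) (A : operator H).
Hypothesis ipn : induces_norm ip.
Hypothesis accA : forall x, op_dom A x -> 0 <= rip ip (A x) x.
Variable C : R.
Hypothesis C0 : 0 <= C.
Hypothesis resA : forall (z : R[i]) x, 0 <= complex.Re z -> op_dom A x ->
  cabs (z + 1) * rnorm x <= C * rnorm (A x + z *: x).

Section Step.
Variables (s : R) (V : {linear H -> H}).
Hypotheses (s0 : 0 < s)
  (VP : forall x, op_dom A (V x) /\ V x + s%:C *: A (V x) = x)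
  (Vq : forall u, op_dom A u -> rip ip (A (V u)) (V u) <= rip ip (A u) u).

(** Divide [euler_root] by [s] and apply [resA] at [z = (1 - w) / s]: [Re z >= 0] since [|w| = 1],
    and [z + 1 = (1 + s - w) / s]. The 2 comes from [|u - v_n| <= 2 |u|]. *)
Lemma euler_root_le u n (w : R[i]) : op_dom A u -> w ^+ n = 1 -> (0 < n)%N ->
  cabs (1 + s%:C - w) * rnorm (\sum_(k < n) w ^+ k *: iter k.+1 V u)
  <= 2 * C * rnorm u.
Proof.
move=> Du wn n0; have [Dy yE] := euler_root ipn accA s0 VP Vq Du wn.
set y := \sum_(k < n) _ in Dy yE *.
have sC : s%:C != 0 by rewrite fmorph_eq0 gt_eqF.
have w1 : cabs w = 1.
  apply/eqP; rewrite -(@pexpr_eq1 _ _ n) ?cabs_ge0 // -cabsX wn.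
  by rewrite /cabs normr1.
have zE : (1 - w) / s%:C + 1 = (1 + s%:C - w) / s%:C by field.
have Rez : 0 <= complex.Re ((1 - w) / s%:C).
  have : (1 - w) / s%:C = (s^-1)%:C * (1 - w) by rewrite fmorphV mulrC.
  move=> ->; have := Re_le_cabs w; rewrite w1 ler_norml => /andP[_].
  case: (w) => a b /= ab; rewrite mul0r subr0 mulr_ge0 ?invr_ge0 ?subr_ge0 //.
  exact: ltW.
have := resA Rez Dy; rewrite zE cabsM cabsV cabs_real gtr0_norm //.
have -> : A y + ((1 - w) / s%:C) *: y = (s^-1)%:C *: (u - iter n V u).
  by rewrite -yE fmorphV scalerDr !scalerA mulVf // scale1r (mulrC _^-1).
rewrite rnormZ cabs_real gtr0_norm ?invr_gt0 // => h.
have [_ _ _ vn] := euler_iter ipn accA s0 VP Vq n Du.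
have un : rnorm (u - iter n V u) <= 2 * rnorm u.
  by rewrite (le_trans (rnormB _ _)) // mulr2n mulrDl mul1r lerD2l.
rewrite -(ler_pM2l (x := s^-1)) ?invr_gt0 //.
apply: (le_trans (le_trans _ h)); first by rewrite mulrA (mulrC s^-1).
rewrite mulrCA ler_pM2l ?invr_gt0 // -mulrA mulrCA ler_wpM2l //.
Qed.

(* Comparing the Fourier transform of the iterates with that of the geometric
   sequence of ratio 1/(1+s). *)
Lemma euler_sum u n : op_dom A u -> (0 < n)%N -> 1 <= n%:R * s ->
  s * \sum_(k < n) rnorm (iter k.+1 V u) ^+ 2 <= 16 * C ^+ 2 * rnorm u ^+ 2.
Proof.
move=> Du n0 ns; have [z zn] := exists_prim_root R[i] n0.
pose b := (1 + s)^-1; have s1 : 0 < 1 + s by rewrite addr_gt0.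
have b0 : 0 < b by rewrite invr_gt0.
have b1 : b < 1 by rewrite invf_lt1 // ltrDl.
(* By Bernoulli and [1 <= n s], [(1 + s)^n >= 2]. *)
have bn : b ^+ n <= 2^-1.
  rewrite exprVn lef_pV2 ?posrE ?exprn_gt0 //.
  by rewrite (le_trans _ (Bernoulli_exprn n (ltW s0))) // lerD2l.
(* The weight in [euler_root_le] factors as [1 + s - w = (1 + s) (1 - w b)], and the geometric sum
   [g] satisfies [(1 - w b) g = 1 - b^n >= 1/2]. Multiplying by [|g|] cancels the dependence on [w]
   and turns [2 C] into [4 C]. *)
have term (j : 'I_n) : (1 + s) * rnorm (\sum_(k < n) (z ^+ j) ^+ k *: iter k.+1 V u)
    <= 4 * C * rnorm (\sum_(k < n) (z ^+ j) ^+ k *: ((b ^+ k)%:C *: u)).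
  set w := z ^+ j.
  have wn : w ^+ n = 1 by rewrite /w exprAC (prim_expr_order zn) expr1n.
  have := euler_root_le Du wn n0; set y := rnorm (\sum_(k < n) _) => yu.
  have y0 : 0 <= y by exact: rnorm_ge0.
  have -> : \sum_(k < n) w ^+ k *: ((b ^+ k)%:C *: u) =
      (\sum_(k < n) (w * b%:C) ^+ k) *: u.
    rewrite scaler_suml; apply: eq_bigr => k _.
    by rewrite scalerA exprMn rmorphXn.
  rewrite rnormZ; set g := \sum_(k < n) _.
  have gE : cabs (1 - w * b%:C) * cabs g = 1 - b ^+ n.
    have : (1 - w * b%:C) * g = (1 - b ^+ n)%:C.
      rewrite -opprB mulNr -subrX1 exprMn wn mul1r opprB.
      by rewrite rmorphB rmorphXn rmorph1.
    by rewrite -cabsM => ->; rewrite cabs_real ger0_norm //; lra.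
  have wE : cabs (1 + s%:C - w) = (1 + s) * cabs (1 - w * b%:C).
    have -> : 1 + s%:C - w = (1 + s)%:C * (1 - w * b%:C).
      rewrite mulrBr mulr1 mulrCA -rmorphM divff ?gt_eqF // rmorph1 mulr1.
      by rewrite rmorphD rmorph1.
    by rewrite cabsM cabs_real gtr0_norm.
  have g0 := cabs_ge0 g; have u0 := rnorm_ge0 u.
  rewrite wE in yu.
  have := ler_wpM2l g0 yu.
  have -> : cabs g * ((1 + s) * cabs (1 - w * b%:C) * y) =
            (1 + s) * y * (cabs (1 - w * b%:C) * cabs g) by ring.
  rewrite gE => h.
  have h2 : (1 + s) * y * 2^-1 <= (1 + s) * y * (1 - b ^+ n).
    by rewrite ler_wpM2l //; [rewrite mulr_ge0 // ltW | lra].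
  lra.
have tsum : (1 + s) ^+ 2 * (n%:R * \sum_(k < n) rnorm (iter k.+1 V u) ^+ 2) <=
    (4 * C) ^+ 2 * (n%:R * \sum_(k < n) rnorm ((b ^+ k)%:C *: u) ^+ 2).
  rewrite -(parseval ipn (fun k => iter k.+1 V u) zn).
  rewrite -(parseval ipn (fun k => (b ^+ k)%:C *: u) zn).
  rewrite !mulr_sumr; apply: ler_sum => j _.
  rewrite -!exprMn ler_pXn2r ?nnegrE ?term ?mulr_ge0 ?rnorm_ge0 //.
  exact: ltW.
(* Replacing [b^(2k)] by the larger [b^k] leaves [(1 - b) \sum_k b^k = 1 - b^n <= 1]. *)
have gsum : (1 - b) * \sum_(k < n) rnorm ((b ^+ k)%:C *: u) ^+ 2 <= rnorm u ^+ 2.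
  apply: (@le_trans _ _ ((1 - b) * (\sum_(k < n) b ^+ k) * rnorm u ^+ 2)).
    rewrite -mulrA ler_wpM2l ?subr_ge0 ?(ltW b1) // mulr_suml ler_sum // => k _.
    rewrite rnormZ exprMn ler_wpM2r ?sqr_ge0 // cabs_real normrX gtr0_norm //.
    rewrite -exprM ler_wiXn2l ?(ltW b0) ?(ltW b1) // muln2 -addnn leq_addr //.
  rewrite -opprB mulNr -subrX1 opprB ler_piMl ?sqr_ge0 // gerBl.
  by rewrite exprn_ge0 // ltW.
set S1 := \sum_(k < n) _ in tsum *; set S2 := \sum_(k < n) _ in tsum gsum.
have nR : 0 < n%:R :> R by rewrite ltr0n.
have {}tsum : (1 + s) ^+ 2 * S1 <= 16 * C ^+ 2 * S2.
  rewrite -(ler_pM2l nR) mulrCA [leRHS]mulrCA (le_trans tsum) //.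
  by rewrite exprMn; lra.
(* After multiplication of [tsum] by [1 - b], one factor [1 + s] produces the step size [s]; the
   other is bounded below by 1. *)
have bE : (1 + s) * (1 - b) = s.
  by rewrite mulrBr mulr1 divff ?gt_eqF // addrC addKr.
have c1 : 16 * C ^+ 2 * ((1 - b) * S2) <= 16 * C ^+ 2 * rnorm u ^+ 2.
  by rewrite ler_wpM2l // mulr_ge0 ?sqr_ge0.
apply: le_trans c1; have S10 : 0 <= S1 by apply: sumr_ge0 => k _; exact: sqr_ge0.
have b1' : 0 <= 1 - b by rewrite subr_ge0 ltW.
have := ler_wpM2l b1' tsum.
have -> : (1 - b) * ((1 + s) ^+ 2 * S1) = (1 + s) * (1 - b) * (1 + s) * S1 by ring.
rewrite bE mulrCA; apply: le_trans.
by rewrite -mulrA ler_pM2l // ler_peMl // lerDl ltW.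
Qed.

End Step.

(** Take [n] steps of size [s = T / n]. Inserting [euler_lower] into [euler_sum] gives [T (|u|^2 - T
    (2 q + s a)) <= 16 C^2 |u|^2], where [q = Re (Au|u)] and [a = |Au|^2]. The choice of [T] makes
    the right side at most [T |u|^2 / 2], so [|u|^2 <= 4 T q + 2 T s a], with an error vanishing as
    [n] grows. *)
Lemma accretive_coercive (s1 : R) : 0 < s1 ->
  (forall s, 0 < s -> s < s1 -> exists V : {linear H -> H},
    (forall x, op_dom A (V x) /\ V x + s%:C *: A (V x) = x) /\
    (forall u, op_dom A u -> rip ip (A (V u)) (V u) <= rip ip (A u) u)) ->
  forall u, op_dom A u -> rnorm u ^+ 2 <= 4 * (1 + 32 * C ^+ 2) * rip ip (A u) u.
Proof.
move=> s10 VA u Du; pose T := 1 + 32 * C ^+ 2; rewrite -/T.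
have T1 : 1 <= T by rewrite lerDl mulr_ge0 ?sqr_ge0.
have T0 : 0 < T by rewrite (lt_le_trans ltr01).
apply/ler_addgt0Pr => e e0.
pose a := rnorm (A u) ^+ 2; have a0 : 0 <= a by exact: sqr_ge0.
(* For [n > M], the first term ensures [s < s1] and the second [2 T s a <= e]. *)
pose M := T / s1 + 2 * T ^+ 2 * a / e.
have M1 : 0 <= T / s1 by rewrite divr_ge0 ?ltW.
have M2 : 0 <= 2 * T ^+ 2 * a / e.
  by rewrite divr_ge0 ?(ltW e0) // mulr_ge0 // mulr_ge0 ?sqr_ge0.
pose n := (Num.truncn M).+1.
have nM : M < n%:R by rewrite /n truncnS_gt.
have n0 : 0 < n%:R :> R by rewrite ltr0n.
pose s := T / n%:R.
have s0 : 0 < s by rewrite divr_gt0.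
have ns : n%:R * s = T by rewrite /s mulrC divfK // gt_eqF.
have s_lt : s < s1.
  by rewrite /s ltr_pdivrMr // -ltr_pdivrMl // mulrC (le_lt_trans _ nM) // lerDl.
have se : 2 * T * s * a <= e.
  have -> : 2 * T * s * a = 2 * T ^+ 2 * a / n%:R by rewrite /s; ring.
  by rewrite ler_pdivrMr // -ler_pdivrMl // mulrC (le_trans _ (ltW nM)) // lerDr.
have [V [VP Vq]] := VA s s0 s_lt.
have := @euler_sum s V s0 VP Vq u n Du (ltn0Sn _).
rewrite ns => /(_ T1).
pose q := rip ip (A u) u; have q0 : 0 <= q by exact: accA.
have : \sum_(k < n) (rnorm u ^+ 2 - n%:R * (2 * s * q + s ^+ 2 * a)) <=
    \sum_(k < n) rnorm (iter k.+1 V u) ^+ 2.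
  apply: ler_sum => k _.
  apply: le_trans (euler_lower ipn accA s0 VP Vq k.+1 Du).
  rewrite lerD2l lerN2 ler_wpM2r ?ler_nat //.
  by rewrite addr_ge0 // mulr_ge0 ?sqr_ge0 // mulr_ge0 // ltW.
rewrite sumr_const card_ord -[X in X <= _]mulr_natl.
move=> /(ler_wpM2l (ltW s0)) h /(le_trans h).
rewrite mulrA (mulrC s) ns -/q.
have -> : n%:R * (2 * s * q + s ^+ 2 * a) = (n%:R * s) * (2 * q + s * a) by ring.
rewrite ns; set N := rnorm u ^+ 2 => h2.
have N0 : 0 <= N by exact: sqr_ge0.
have C2 : 16 * C ^+ 2 <= T / 2 by rewrite /T; lra.
have {}C2 := ler_wpM2r N0 C2.
have : N - T * (2 * q + s * a) <= 2^-1 * N.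
  by rewrite -(ler_pM2l T0) [leRHS]mulrA (le_trans h2).
move: se; lra.
Qed.

End Core.

(** * Log-convexity along orbits *)

Section NormCvg.
Context {R : realType} {H : normedModType R[i]}.

Lemma cvg_rnormP T (F : set_system T) {FF : Filter F} (f : T -> H) (l : H) :
  f x @[x --> F] --> l <->
  forall e : R, 0 < e -> \forall x \near F, rnorm (l - f x) < e.
Proof.
split=> [fl e e0|fl].
  have eC : 0 < e%:C :> R[i] by rewrite ltcR.
  have /cvgrPdist_lt/(_ _ eC) := fl; apply: filterS => x.
  by rewrite normHE ltcR.
apply/cvgrPdist_lt => e e0.
have eE : e = (complex.Re e)%:C by rewrite RRe_real // gtr0_real.
have : 0 < complex.Re e by rewrite -ltcR -eE.
by move=> /fl; apply: filterS => x; rewrite [in X in _ -> X]eE normHE ltcR.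
Qed.

Lemma cvg_rnorm T (F : set_system T) {FF : Filter F} (f : T -> H) (l : H) :
  f x @[x --> F] --> l -> rnorm (f x) @[x --> F] --> rnorm l.
Proof.
move=> /cvg_rnormP fl; apply/cvgrPdist_lt => e /fl; apply: filterS => x.
apply: le_lt_trans; have h (a b : H) : rnorm a - rnorm b <= rnorm (a - b).
  by rewrite lerBlDr (le_trans _ (rnormD _ _)) // subrK.
by rewrite ler_norml h andbT lerNl opprB -(rnormN (l - _)) opprB h.
Qed.

Variable ip : {dot H for @Num.conj R[i]}.
Hypothesis ipn : induces_norm ip.

(** Polarization reduces this to continuity of the norm. *)
Lemma cvg_rip T (F : set_system T) {FF : Filter F} (f g : T -> H) (l k : H) :
  f x @[x --> F] --> l -> g x @[x --> F] --> k ->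
  rip ip (f x) (g x) @[x --> F] --> rip ip l k.
Proof.
move=> fl gk.
have ripE a b : rip ip a b =
    2^-1 * (rnorm (a + b) ^+ 2 - rnorm a ^+ 2 - rnorm b ^+ 2).
  by rewrite (rnormD_sqr ipn); field.
rewrite ripE; under eq_fun do rewrite ripE.
by apply: cvgM; [exact: cvg_cst|];
  apply: cvgB; [apply: cvgB|]; rewrite expr2; under eq_fun do rewrite expr2;
  apply: cvgM; apply: cvg_rnorm => //; apply: cvgD.
Qed.

End NormCvg.

Section LogConvexSlope.
Context {R : realType}.

(** The chord slope [c] of [ln h] over [[0, t]] separates the logarithmic derivatives:
    [d0 / h 0 <= c <= d1 / h t]. The inequality [ln x <= x - 1] passes from quotients of [ln h] to
    quotients of [h]. *)
Lemma log_convex_slope (h : R -> R) (t d0 d1 : R) :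
  log_convex h -> 0 < t -> 0 < h 0 -> 0 < h t ->
  h s @[s --> 0^'+] --> h 0 -> h (t + s) @[s --> 0^'+] --> h t ->
  (h s - h 0) / s @[s --> 0^'+] --> d0 ->
  (h (t + s) - h t) / s @[s --> 0^'+] --> d1 ->
  d0 * h t <= d1 * h 0.
Proof.
move=> hc t0 h0 ht c0 ct s0 st.
have lnB1 (x : R) : 0 < x -> ln x <= x - 1.
  by move=> x0; rewrite -{1}[x](subrKC 1) le_ln1Dx // ltrBrDl subrr.
pose c := (ln (h t) - ln (h 0)) / t.
have le0 : d0 <= c * h 0.
  apply: (ler_cvg_to s0 (cvgM (cvg_cst c) c0)); near=> s.
  have sp : 0 < s by near: s; exact: nbhs_right_gt.
  have slt : s < t by near: s; exact: nbhs_right_lt.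
  have hs : 0 < h s by near: s; exact: (cvgr_gt _ c0).
  have := hc 0 s t (lexx _) sp slt; rewrite !subr0.
  rewrite -ler_ln ?posrE ?mulr_gt0 ?powR_gt0 //.
  rewrite lnM ?posrE ?powR_gt0 // !ln_powR => h1.
  have := lnB1 (h 0 / h s) (divr_gt0 h0 hs); rewrite ln_div ?posrE // => h2.
  rewrite ler_pdivrMr //.
  have h3 : (h s - h 0) <= (ln (h s) - ln (h 0)) * h s.
    rewrite -ler_pdivrMr // mulrBl divff ?gt_eqF //; lra.
  apply: (le_trans h3); rewrite mulrAC ler_pM2r //.
  have -> : c * s = s / t * ln (h t) - s / t * ln (h 0) by rewrite /c; ring.
  move: h1; rewrite mulrBl divff ?gt_eqF //; lra.
have le1 : c * h t <= d1.
  apply: (ler_cvg_to (cvg_cst (c * h t)) st); near=> s.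
  have sp : 0 < s by near: s; exact: nbhs_right_gt.
  have hs : 0 < h (t + s) by near: s; exact: (cvgr_gt _ ct).
  have ts : t < t + s by rewrite ltrDl.
  have tsp : 0 < t + s by rewrite addr_gt0.
  have := hc 0 t (t + s) (lexx _) t0 ts; rewrite !subr0.
  rewrite -ler_ln ?posrE ?mulr_gt0 ?powR_gt0 //.
  rewrite lnM ?posrE ?powR_gt0 // !ln_powR => h1.
  have := lnB1 (h (t + s) / h t) (divr_gt0 hs ht); rewrite ln_div ?posrE // => h2.
  have h3 : s * (ln (h t) - ln (h 0)) <= t * (ln (h (t + s)) - ln (h t)).
    have ea : (t + s - t) / (t + s) * (t + s) = s.
      by rewrite divfK ?gt_eqF // addrC addKr.
    have eb : t / (t + s) * (t + s) = t by rewrite divfK ?gt_eqF.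
    move: h1 ea eb; set a := _ / _; set b := t / _ => h1 ea eb.
    have := ler_wpM2l (ltW tsp) h1.
    rewrite mulrDr (mulrCA _ a) (mulrCA _ b) (mulrA a) (mulrA b) ea eb; lra.
  have h4 : c * s <= ln (h (t + s)) - ln (h t).
    by rewrite /c mulrAC ler_pdivrMr // (mulrC _ s) (mulrC _ t).
  rewrite ler_pdivlMr //; apply: le_trans (_ : c * s * h t <= _).
    by rewrite mulrAC.
  by rewrite -ler_pdivlMr // mulrBl divff ?gt_eqF // (le_trans h4).
rewrite (le_trans (y := c * h 0 * h t)) ?ler_wpM2r ?(ltW ht) //.
by rewrite mulrAC ler_wpM2r // ltW.
Unshelve. all: by end_near. Qed.

End LogConvexSlope.

Section Semigroup.
Context {R : realType} {H : normedModType R[i]}.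
Variables (ip : {dot H for @Num.conj R[i]}) (A : operator H).
Variable S : R -> {linear H -> H}.
Hypotheses (ipn : induces_norm ip) (S0 : C0_semigroup S)
  (SA : generated_by_opp A S).
Implicit Types x y : H.

Lemma generator_quotient x : op_dom A x ->
  (t^-1)%:C *: (S t x - x) @[t --> 0^'+] --> - A x.
Proof. by move=> Dx; apply/SA. Qed.

(** [S t] is continuous and commutes with the difference quotients of the semigroup, so those at
    [S t x] converge to [- S t (A x)]. *)
Lemma generator_dom t x : 0 <= t -> op_dom A x ->
  op_dom A (S t x) /\ A (S t x) = S t (A x).
Proof.
move=> t0 Dx; have [Sc S00 SD _] := S0.
suff /SA[DS /eqP] : (r^-1)%:C *: (S r (S t x) - S t x) @[r --> 0^'+] -->
    - S t (A x) by rewrite eqr_opp => /eqP.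
have -> : - S t (A x) = S t (- A x) by rewrite linearN.
apply: cvg_trans; last first.
  exact: (cvg_comp _ _ (generator_quotient Dx) (Sc t t0 (- A x))).
apply: near_eq_cvg; near=> r.
have r0 : 0 < r by near: r; exact: nbhs_right_gt.
have -> : S r (S t x) = S t (S r x) by rewrite -!SD ?(ltW r0) // addrC.
by rewrite /= linearZ linearB.
Unshelve. all: by end_near. Qed.

Hypothesis Slc : forall u, u != 0 -> log_convex (fun t => rnorm (S t u)).
Hypothesis Sder : forall u, op_dom A u -> `|u| = 1 ->
  (rnorm (S t u) - rnorm (S 0 u)) / t @[t --> 0^'+] --> - rip ip (A u) u.

(** [Sder] treats unit vectors; both sides are positively homogeneous of degree one in [x]. *)
Lemma orbit_right_derivative x : op_dom A x -> x != 0 ->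
  (rnorm (S t x) - rnorm x) / t @[t --> 0^'+]
    --> - (rip ip (A x) x / rnorm x).
Proof.
move=> Dx x0; have [_ S00 _ _] := S0.
have px : 0 < rnorm x by rewrite rnorm_gt0.
pose u := ((rnorm x)^-1)%:C *: x.
have Nu : `|u| = 1.
  rewrite normHE rnormZ cabs_real gtr0_norm ?invr_gt0 // mulVf ?gt_eqF //.
have := Sder (op_domZ _ Dx) Nu.
have -> : - rip ip (A u) u = (rnorm x)^-1 * - (rip ip (A x) x / rnorm x).
  by rewrite opZ // ripZl ripZr; field; rewrite gt_eqF.
move=> /(cvgM (cvg_cst (rnorm x))); rewrite mulVKf ?gt_eqF //.
apply: cvg_trans; apply: near_eq_cvg; near=> t.
rewrite /= S00 /u linearZ /= !rnormZ cabs_real gtr0_norm ?invr_gt0 //.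
by rewrite -mulrBr !mulrA divff ?mul1r // gt_eqF.
Unshelve. all: by end_near. Qed.

(** This is [log_convex_slope] along the orbit: by the semigroup law, the right derivative at [t] is
    the one at 0 for the orbit of [S t x]. *)
Lemma orbit_rayleigh t x : op_dom A x -> 0 < t ->
  rip ip (A (S t x)) (S t x) * rnorm x ^+ 2 <=
  rip ip (A x) x * rnorm (S t x) ^+ 2.
Proof.
move=> Dx t0; have [Sc S00 SD Scv] := S0.
have [x0|x0] := eqVneq x 0.
  by rewrite x0 linear0 op0 // rip0l !mul0r.
have [Dv _] := generator_dom (ltW t0) Dx.
have [v0|v0] := eqVneq (S t x) 0.
  by rewrite v0 op0 rip0l rnorm0 expr0n mulr0 mul0r.
have px : 0 < rnorm x by rewrite rnorm_gt0.
have pv : 0 < rnorm (S t x) by rewrite rnorm_gt0.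
have SDt : \forall s \near 0^'+, rnorm (S (t + s) x) = rnorm (S s (S t x)).
  near=> s; have s0 : 0 < s by near: s; exact: nbhs_right_gt.
  by rewrite addrC SD // ltW.
have := @log_convex_slope R (fun s => rnorm (S s x)) t _ _ (Slc x0) t0.
rewrite S00 => /(_ _ _ px pv (cvg_rnorm (Scv x))).
move=> /(_ (- (rip ip (A x) x / rnorm x))
  (- (rip ip (A (S t x)) (S t x) / rnorm (S t x)))) h.
have {h} := h _ (orbit_right_derivative Dx x0) _.
rewrite !mulNr lerN2 => h.
have {h} : rip ip (A (S t x)) (S t x) / rnorm (S t x) * rnorm x <=
    rip ip (A x) x / rnorm x * rnorm (S t x).
  apply: h.
    apply: cvg_trans (cvg_rnorm (Scv (S t x))); apply: near_eq_cvg.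
    by apply: filterS SDt => s ->.
  apply: cvg_trans (orbit_right_derivative Dv v0); apply: near_eq_cvg.
  by apply: filterS SDt => s ->.
rewrite -(ler_pM2r (mulr_gt0 px pv)).
set a := rip _ _ _; set b := rip _ _ _ => h.
have -> : a * rnorm x ^+ 2 =
    a / rnorm (S t x) * rnorm x * (rnorm x * rnorm (S t x)).
  by field; rewrite gt_eqF.
by rewrite (le_trans h) // le_eqVlt; apply/orP; left; apply/eqP; field;
  rewrite gt_eqF.
Unshelve. all: by end_near. Qed.

(** First-order form of [orbit_rayleigh] at [t = 0]: put [S t x = x + t D] and
    [A (S t x) = A x + t E], cancel the terms of order zero, divide by [t], and let [D] tend to
    [- A x] and [E] to [- A (A x)]. *)
Lemma log_convex_generator x : op_dom A x -> op_dom A (A x) ->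
  2 * rip ip (A x) x ^+ 2 <=
  (rip ip (A (A x)) x + rnorm (A x) ^+ 2) * rnorm x ^+ 2.
Proof.
move=> Dx DAx; pose D t := (t^-1)%:C *: (S t x - x).
pose E t := (t^-1)%:C *: (S t (A x) - A x).
have Dl : D t @[t --> 0^'+] --> - A x := generator_quotient Dx.
have El : E t @[t --> 0^'+] --> - A (A x) := generator_quotient DAx.
have tl : t @[t --> (0:R)^'+] --> (0 : R) by exact: cvg_within.
have lhs : (rip ip (E t) x + rip ip (A x) (D t) + t * rip ip (E t) (D t)) *
    rnorm x ^+ 2 @[t --> 0^'+] -->
    (rip ip (- A (A x)) x + rip ip (A x) (- A x) +
     0 * rip ip (- A (A x)) (- A x)) * rnorm x ^+ 2.
  apply: cvgM; last exact: cvg_cst.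
  apply: cvgD; [apply: cvgD|apply: cvgM => //]; apply: cvg_rip => //;
    exact: cvg_cst.
have rhs : rip ip (A x) x * (2 * rip ip x (D t) + t * rip ip (D t) (D t))
    @[t --> 0^'+] -->
    rip ip (A x) x * (2 * rip ip x (- A x) + 0 * rip ip (- A x) (- A x)).
  apply: cvgM; first exact: cvg_cst.
  by apply: cvgD; apply: cvgM; rewrite //; [exact: cvg_cst|..];
    apply: cvg_rip => //; exact: cvg_cst.
have := ler_cvg_to lhs rhs _.
rewrite !mul0r !addr0 ripNl !ripNr (rip_sqr ipn (A x)) (ripC x) => h.
have key : (- rip ip (A (A x)) x - rnorm (A x) ^+ 2) * rnorm x ^+ 2 <=
  rip ip (A x) x * (2 * - rip ip (A x) x); last by lra.
apply: h; near=> t; have t0 : 0 < t by near: t; exact: nbhs_right_gt.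
have tC : t%:C != 0 :> R[i] by rewrite fmorph_eq0 gt_eqF.
have SE : S t x = x + t%:C *: D t.
  by rewrite /D scalerA -rmorphM divff ?gt_eqF // scale1r subrKC.
have ASE : A (S t x) = A x + t%:C *: E t.
  rewrite /E scalerA -rmorphM divff ?gt_eqF // scale1r subrKC.
  by have [] := generator_dom (ltW t0) Dx.
move: (D t) (E t) SE ASE => d e SE ASE.
have := orbit_rayleigh Dx t0; rewrite ASE SE.
rewrite -(rip_sqr ipn (x + _)) !(ripDl, ripDr, ripZl, ripZr) (ripC d x).
rewrite (rip_sqr ipn x); move=> h; rewrite -(ler_pM2l t0); lra.
Unshelve. all: by end_near. Qed.

(** With [y = V u], so [u = y + s B y], expansion gives [q u = q y + s (Re (B^2 y|y) + |By|^2) + s^2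
    q (B y)]. The last term is nonnegative by the choice of [m], the middle one by [key]. *)
Lemma euler_step_decr (m s : R) (V : H -> H) :
  (forall x, op_dom A x -> m * rnorm x ^+ 2 <= rip ip (A x) x) ->
  0 < s ->
  (forall x, op_dom A (V x) /\ V x + s%:C *: shift_operator A m (V x) = x) ->
  forall u, op_dom A u ->
    rip ip (shift_operator A m (V u)) (V u) <= rip ip (shift_operator A m u) u.
Proof.
move=> mA s0 VP u Du; have [Dy yE] := VP u; set y := V u in Dy yE *.
set B := shift_operator A m in yE *.
have sC : s%:C != 0 :> R[i] by rewrite fmorph_eq0 gt_eqF.
have DBy : op_dom A (B y).
  rewrite -[B y]scale1r -(mulVf sC) -scalerA; apply: op_domZ.
  by rewrite -[_ *: _](addKr y) yE addrC; exact: op_domB.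
have DAy : op_dom A (A y).
  by rewrite -[A y](subrK (m%:C *: y)); apply/op_domD/op_domZ.
have pos z : op_dom A z -> 0 <= rip ip (B z) z.
  move=> Dz; rewrite /B /= ripDl ripNl ripZl (rip_sqr ipn) subr_ge0; exact: mA.
(* Times [|y|^2], [log_convex_generator] bounds this below by [2 (Re (Ay|y) - m |y|^2)^2]. *)
have key : 0 <= rip ip (B (B y)) y + rip ip (B y) (B y).
  have [y0|y0] := eqVneq y 0.
    by rewrite y0 !(op0, rip0l) addr0.
  have py : 0 < rnorm y ^+ 2 by rewrite exprn_gt0 // rnorm_gt0.
  rewrite -(pmulr_lge0 _ py) /B /= opB ?opZ //; last exact: op_domZ.
  rewrite !(ripDl, ripDr, ripNl, ripNr, ripZl, ripZr) !(rip_sqr ipn) (ripC y).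
  have := log_convex_generator Dy DAy.
  have := sqr_ge0 (rip ip (A y) y - m * rnorm y ^+ 2); nra.
have Dsy := op_domZ s%:C DBy.
have := mulr_ge0 (ltW s0) key; have := mulr_ge0 (sqr_ge0 s) (pos _ DBy).
rewrite -yE (opD (A := B)) // (opZ (A := B)) //.
move: (B (B y)) (B y) => b2 b1.
rewrite !(ripDl, ripDr, ripZl, ripZr); lra.
Qed.

End Semigroup.

(** * Resolvents *)

(* [banach_fixed_point] does not apply: it needs scalars in a [realType]. *)
Lemma rnorm_contraction_fixpoint (R : realType) (H : completeNormedModType R[i])
    (f : H -> H) (c : R) : 0 <= c -> c < 1 ->
  (forall x y, rnorm (f x - f y) <= c * rnorm (x - y)) -> exists x, f x = x.
Proof.
move=> c0 c1 fc; pose u n := iter n f 0; pose M := rnorm (f 0) / (1 - c).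
have c1' : 0 < 1 - c by rewrite subr_gt0.
(* [M] solves [c M + |f 0| = M], so the bound propagates along the iteration. *)
have uM k : rnorm (u k - 0) <= M.
  elim: k => [|k IH]; first by rewrite subrr rnorm0 divr_ge0 ?rnorm_ge0 // ltW.
  rewrite subr0 [u _]/= -[f _](subrK (f 0)) (le_trans (rnormD _ _)) //.
  rewrite (le_trans (lerD (fc _ _) (lexx _))) //.
  rewrite (le_trans (lerD (ler_wpM2l c0 IH) (lexx _))) //.
  have : M * (1 - c) = rnorm (f 0) by rewrite divfK // gt_eqF.
  lra.
have ucauchy n k : rnorm (u (n + k)%N - u n) <= c ^+ n * M.
  elim: n => [|n IH]; first by rewrite expr0 mul1r; exact: uM.
  rewrite addSn [u _.+1]/= [X in _ - X]/= (le_trans (fc _ _)) //.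
  by rewrite exprS -mulrA ler_wpM2l.
have cM : c ^+ n * M @[n --> \oo] --> 0 * M.
  by apply: cvgM; [apply: cvg_expr; rewrite ger0_norm|exact: cvg_cst].
have {}cM (e : R) : 0 < e -> exists n, forall k, rnorm (u (n + k)%N - u n) < e.
  move=> e0; move: cM; rewrite mul0r => /cvgr_lt/(_ _ e0)[n _ ne].
  by exists n => k; rewrite (le_lt_trans (ucauchy _ _)) //; exact/ne/leqnn.
have /cauchy_cvgP ucvg : cauchy (u n @[n --> \oo]).
  apply: cauchy_exP => e e0.
  have eE : e = (complex.Re e)%:C by rewrite RRe_real // gtr0_real.
  have Re0 : 0 < complex.Re e by rewrite -ltcR -eE.
  have [n nP] := cM _ Re0; exists (u n), n => //= m /= nm.
  by rewrite -ball_normE /= distrC normHE eE ltcR -(subnKC nm).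
have /cvg_ex[l ul] := ucvg.
exists l; apply/eqP; rewrite -subr_eq0 -rnorm_eq0 eq_le rnorm_ge0 andbT.
apply/ler_addgt0Pl => e e0; rewrite addr0.
have e2 : 0 < e / 2 by rewrite divr_gt0.
have /cvg_rnormP/(_ _ e2)[n _ nP] := ul.
have h1 := nP n (leqnn n); have h2 := nP n.+1 (leqnSn n).
rewrite -(subrKA (f (u n))) (le_trans (rnormD _ _)) // [e]splitr lerD //.
  rewrite (le_trans (fc _ _)) // (le_trans (ler_piMl _ (ltW c1))) ?rnorm_ge0 //.
  exact: ltW.
by rewrite -rnormN opprB ltW.
Qed.

Section Resolvent.
Context {R : realType} {H : normedModType R[i]}.
Variable A : operator H.

Lemma is_resolvent_bound (z : R[i]) (T : {linear H -> H}) : is_resolvent A z T ->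
  exists2 K : R, 0 < K &
    forall x, op_dom A x -> rnorm x <= K * rnorm (A x + z *: x).
Proof.
move=> [/linear_bounded_continuous/linear_boundedP/pinfty_ex_gt0[K K0 TK] _ TA].
have KE : K = (complex.Re K)%:C by rewrite RRe_real // gtr0_real.
exists (complex.Re K) => [|x Dx]; first by rewrite -ltcR -KE.
by rewrite -{1}(TA x Dx) -lecR rmorphM /= -KE -!normHE.
Qed.

(** The a priori bound yields uniqueness of preimages, hence linearity of a chosen inverse, and then
    its continuity. *)
Lemma is_resolvent_exists (z : R[i]) (K : R) :
  (forall y, exists2 x, op_dom A x & A x + z *: x = y) ->
  (forall x, op_dom A x -> rnorm x <= K * rnorm (A x + z *: x)) ->
  exists T : {linear H -> H}, is_resolvent A z T.
Proof.
move=> surj AK.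
have inj x y : op_dom A x -> op_dom A y -> A x + z *: x = A y + z *: y -> x = y.
  move=> Dx Dy xy; apply/eqP; rewrite -subr_eq0 -rnorm_eq0 eq_le rnorm_ge0 andbT.
  rewrite (le_trans (AK _ (op_domB Dx Dy))) // opB // scalerBr addrACA xy.
  by rewrite -opprD subrr rnorm0 mulr0.
have /choice[f fP] y : exists x, op_dom A x /\ A x + z *: x = y.
  by have [x Dx xy] := surj y; exists x.
have flin : linear f.
  move=> a x y; have [[Dx xE] [Dy yE]] := (fP x, fP y).
  have [D E] := fP (a *: x + y).
  apply: inj => //; first exact: op_domP.
  rewrite E op_linear // scalerDr addrACA scalerA (mulrC z) -scalerA -scalerDr.
  by rewrite xE yE.
pose T : {linear H -> H} := HB.pack f (GRing.isLinear.Build R[i] H H _ f flin).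
exists T; split=> [|y|x Dx]; last 2 first.
- exact: fP.
- by apply: inj => //; have [] := fP (A x + z *: x).
apply/linear_bounded_continuous/linear_boundedP; near=> r => y.
have [Dy yE] := fP y; rewrite (@le_trans _ _ (`|K|%:C * `|y|)) //.
  rewrite !normHE -rmorphM lecR (le_trans (AK _ Dy)) //= yE.
  by rewrite ler_wpM2r ?rnorm_ge0 // ler_norm.
rewrite ler_wpM2r //; near: r; apply: nbhs_pinfty_ge.
by rewrite ger0_real // lecR.
Unshelve. all: by end_near. Qed.

End Resolvent.

(** The Neumann series in fixed-point form: [A x + w x = y] amounts to [x = T (y - (w - z) x)],
    whose right side contracts by [K |w - z|]. *)
Lemma is_resolvent_perturb (R : realType) (H : completeNormedModType R[i])
    (A : operator H) (z w : R[i]) (T : {linear H -> H}) (K : R) :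
  is_resolvent A z T -> 0 <= K ->
  (forall x, op_dom A x -> rnorm x <= K * rnorm (A x + z *: x)) ->
  K * cabs (w - z) < 1 -> exists T' : {linear H -> H}, is_resolvent A w T'.
Proof.
move=> [Tc TP TA] K0 AK Kw.
have c0 : 0 <= K * cabs (w - z) by rewrite mulr_ge0 ?cabs_ge0.
have AzE x : A x + w *: x - (w - z) *: x = A x + z *: x.
  by rewrite scalerBl opprB addrACA addrN addr0.
apply: (@is_resolvent_exists _ _ _ _ (K / (1 - K * cabs (w - z)))) => [y|x Dx].
  have [x xE] : exists x, T (y - (w - z) *: x) = x.
    apply: (rnorm_contraction_fixpoint c0 Kw) => a b; rewrite -linearB /=.
    rewrite opprB addrC subrKA -scalerBr; set v := _ *: _.
    have [Dv vE] := TP v; rewrite (le_trans (AK _ Dv)) // vE.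
    by rewrite /v rnormZ -mulrA -(opprB a b) rnormN.
  have [Dx] := TP (y - (w - z) *: x); rewrite xE in Dx *.
  move=> /(congr1 (fun v => v + (w - z) *: x)).
  by rewrite subrK -AzE subrK; exists x.
rewrite mulrAC ler_pdivlMr ?subr_gt0 //.
have : rnorm (A x + z *: x) <= rnorm (A x + w *: x) + cabs (w - z) * rnorm x.
  by rewrite -AzE (le_trans (rnormB _ _)) // rnormZ.
move=> /(ler_wpM2l K0); have := AK _ Dx; lra.
Qed.

(** The argument of [z] is [acos (Re z / |z|)] up to sign, and
    [cos (delta + pi / 2) = - sin delta]. *)
Lemma sectorP (R : realType) (delta : R) (z : R[i]) :
  0 < delta -> delta < pi / 2 -> z != 0 ->
  - (sin delta * cabs z) < complex.Re z -> sector (delta + pi / 2) z.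
Proof.
move=> d0 d2 z0 zd; have r0 : 0 < cabs z.
  by rewrite lt_def cabs_ge0 cabs_eq0 z0.
have := pi_gt0 R => pi0.
pose a := complex.Re z / cabs z.
have aI : -1 <= a <= 1.
  rewrite -ler_norml normrM normfV (gtr0_norm r0) ler_pdivrMr // mul1r.
  exact: Re_le_cabs.
pose phi := acos a.
have phi_lt : phi < delta + pi / 2.
  rewrite -ltr_cos ?in_itv /= ?acos_ge0 ?acos_lepi //; last first.
    by apply/andP; split; lra.
  rewrite acosK ?in_itv //= cosDpihalf /a ltr_pdivlMr // mulNr //.
have phi0 : 0 <= phi by exact: acos_ge0.
have cE : cabs z * cos phi = complex.Re z.
  by rewrite acosK ?in_itv //= mulrC divfK // gt_eqF.
have sE : cabs z * sin phi = `|complex.Im z|.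
  rewrite sin_acos // -{1}(gtr0_norm r0) -sqrtr_sqr -sqrtrM ?sqr_ge0 //.
  rewrite /a -[RHS]sqrtr_sqr; congr Num.sqrt.
  by rewrite mulrBr mulr1 expr_div_n mulrCA divff ?mulr1 ?expf_neq0 ?gt_eqF //
    cabs_sqr addrAC subrr add0r.
have [Im0|Im0] := leP 0 (complex.Im z).
  exists (cabs z), phi; split=> //; first by lra.
  by rewrite cE sE ger0_norm //; case: (z).
exists (cabs z), (- phi); split=> //; [by lra|by lra|].
by rewrite cosN sinN mulrN cE sE ltr0_norm // opprK; case: (z).
Qed.

(** * Resolvent bounds for accretive sectorial operators *)

Section Spectrum.
Context {R : realType} {H : completeNormedModType R[i]}.
Variables (ip : {dot H for @Num.conj R[i]}) (A : operator H).
Hypothesis ipn : induces_norm ip.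
Variables (delta C : R).
Hypotheses (d0 : 0 < delta) (d2 : delta < pi / 2) (C0 : 0 < C).
Hypothesis sectA : forall z : R[i], z = 0 \/ sector (delta + pi / 2) z ->
  exists T : {linear H -> H}, is_resolvent A z T /\
    forall y : H, `|z| * `|T y| <= C%:C * `|y|.

Let sd0 : 0 < sin delta.
Proof. by rewrite sin_gt0_pihalf // d0. Qed.

Lemma sectorial_resolvent (z : R[i]) : - (sin delta * cabs z) < complex.Re z ->
  exists T : {linear H -> H}, is_resolvent A z T.
Proof.
move=> zd; have [z0|z0] := eqVneq z 0.
  by have [T []] := sectA (or_introl z0); exists T.
by have [T []] := sectA (or_intror (sectorP d0 d2 z0 zd)); exists T.
Qed.

Lemma sectorial_bound (z : R[i]) x : - (sin delta * cabs z) < complex.Re z ->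
  op_dom A x -> cabs z * rnorm x <= C * rnorm (A x + z *: x).
Proof.
move=> zd Dx; have [z0|z0] := eqVneq z 0.
  by rewrite z0 /cabs normr0 mul0r mulr_ge0 ?rnorm_ge0 // ltW.
have [T [[_ _ TA] /(_ (A x + z *: x))]] := sectA (or_intror (sectorP d0 d2 z0 zd)).
by rewrite TA // cabsE !normHE -!rmorphM lecR.
Qed.

Lemma cabs_ge0_sin (z : R[i]) : 0 <= sin delta * cabs z.
Proof. by rewrite mulr_ge0 ?cabs_ge0 // ltW. Qed.

(** Invertibility at 0 clears the disc [|z| < 1 / K] of spectrum; outside it, [Re z < sin delta / K]
    forces [- z] into the sector. *)
Lemma spectral_abscissa_gt0 : (0 < spectral_abscissa A)%E.
Proof.
have [T0 [T0P _]] := sectA (or_introl erefl).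
have [K K0 AK] := is_resolvent_bound T0P.
have c0 : 0 < sin delta / K by rewrite divr_gt0.
apply: (@lt_le_trans _ _ (sin delta / K)%:E); first by rewrite lte_fin.
apply: le_ereal_inf_tmp => _ [z zA <-]; rewrite lee_fin leNgt; apply/negP => zc.
apply: zA; have [zK|zK] := ltP (K * cabs (- z - 0)) 1.
  exact: is_resolvent_perturb T0P (ltW K0) AK zK.
apply: sectorial_resolvent; rewrite raddfN ltrN2 (lt_le_trans zc) //.
rewrite subr0 in zK.
by rewrite ler_wpM2l ?(ltW sd0) // -[K^-1]mulr1 ler_pdivrMl.
Qed.

Variable m : R.
Hypothesis m0 : 0 <= m.
Hypothesis mA : forall x, op_dom A x -> m * rnorm x ^+ 2 <= rip ip (A x) x.

(* One Neumann series in a large disc centred on the positive axis suffices. *)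
Lemma half_plane_resolvent (z : R[i]) : - m < complex.Re z ->
  exists T : {linear H -> H}, is_resolvent A z T.
Proof.
case: z => a b /= am; have am0 : 0 < a + m by rewrite -ltrBlDr sub0r.
(* Large enough that [|z - l| < l + m], while [mA] bounds the resolvent at [l] by [1 / (l + m)]. *)
pose l := (a ^+ 2 + b ^+ 2) / (2 * (a + m)) + 1.
have l0 : 0 < l.
  by rewrite ltr_wpDl // divr_ge0 ?addr_ge0 ?sqr_ge0 // mulr_ge0 // ltW.
have lm0 : 0 < l + m by rewrite ltr_wpDr.
have lE : 2 * (a + m) * l = a ^+ 2 + b ^+ 2 + 2 * (a + m).
  by rewrite /l mulrDr mulr1 mulrC divfK // mulf_neq0 // gt_eqF.
have [T TP] : exists T : {linear H -> H}, is_resolvent A l%:C T.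
  apply: sectorial_resolvent; rewrite /= (le_lt_trans _ l0) // oppr_le0.
  exact: cabs_ge0_sin.
apply: (is_resolvent_perturb (K := (l + m)^-1) TP).
- by rewrite invr_ge0 ltW.
- move=> x Dx; rewrite ler_pdivlMl //.
  have [->|x0] := eqVneq x 0; first by rewrite rnorm0 mulr0 rnorm_ge0.
  have px : 0 < rnorm x by rewrite rnorm_gt0.
  rewrite -(ler_pM2r px).
  apply: le_trans (le_trans (ler_norm _) (rip_le ipn (A x + l%:C *: x) x)).
  by rewrite ripDl ripZl (rip_sqr ipn); have := mA Dx; lra.
rewrite ltr_pdivrMl // mulr1.
rewrite -(ltr_pXn2r (n := 2)) ?nnegrE ?cabs_ge0 ?(ltW lm0) //.
by rewrite cabs_sqr /= subr0; have := sqr_ge0 m; nra.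
Qed.

Lemma le_spectral_abscissa : (m%:E <= spectral_abscissa A)%E.
Proof.
apply: le_ereal_inf_tmp => _ [z zA <-]; rewrite lee_fin leNgt; apply/negP => zm.
by apply/zA/half_plane_resolvent; rewrite raddfN ltrN2.
Qed.

Hypothesis m_lt : (m%:E < spectral_abscissa A)%E.

Lemma line_resolvent (b : R) :
  exists T : {linear H -> H}, is_resolvent A ((- m) +i* b) T.
Proof.
have : ~ spectrum A (- ((- m) +i* b)).
  move=> zA; have : (spectral_abscissa A <= m%:E)%E.
    by apply: ge_ereal_inf; exists m%:E => //; exists (- ((- m) +i* b)) => //=;
      rewrite opprK.
  by rewrite leNgt m_lt.
by move/contrapT => [T]; rewrite opprK; exists T.
Qed.

(** A bound [K] at [b] persists as [2 K] within distance [1 / (2 K)]; compactness of [[-r, r]] makes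
    the constant uniform. *)
Lemma segment_bound (r : R) : exists2 K : R, 0 < K & forall b x, `|b| <= r ->
  op_dom A x -> rnorm x <= K * rnorm (A x + ((- m) +i* b) *: x).
Proof.
pose P (K b : R) := forall x, op_dom A x ->
  rnorm x <= K * rnorm (A x + ((- m) +i* b) *: x).
have /compact_near_coveringP/(_ R +oo P _) cover := @segment_compact R (- r) r.
have [|K K0 KP] := pinfty_ex_gt0 (cover _); last first.
  by exists K => // b x br; apply: KP; rewrite /= in_itv /= -ler_norml.
move=> b _; have [T TP] := line_resolvent b.
have [K K0 TK] := is_resolvent_bound TP.
exists ([set b' | `|b - b'| < (2 * K)^-1], [set K' | 2 * K <= K']).
  split=> /=; last by apply: nbhs_pinfty_ge; rewrite num_real.
  by apply/nbhs_normP; exists (2 * K)^-1; rewrite /= ?invr_gt0 ?mulr_gt0.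
move=> [b' K'] /= [bb' KK'] x Dx.
apply: le_trans (ler_wpM2r (rnorm_ge0 _) KK').
have -> : A x + ((- m) +i* b') *: x =
    A x + ((- m) +i* b) *: x - (0 +i* (b - b')) *: x.
  rewrite -addrA -scalerBl; congr (_ + _ *: _).
  by apply/eqP; rewrite eq_complex /= subr0 eqxx /=; apply/eqP; ring.
set w := A x + _; have wx : rnorm x <= K * rnorm w by exact: TK.
have h : rnorm w <= rnorm (w - (0 +i* (b - b')) *: x) + `|b - b'| * rnorm x.
  rewrite -{1}[w](subrK ((0 +i* (b - b')) *: x)) (le_trans (rnormD _ _)) //.
  rewrite lerD2l rnormZ ler_wpM2r ?rnorm_ge0 // (le_trans (cabs_le _)) //=.
  by rewrite normr0 add0r.
have h2 : K * (`|b - b'| * rnorm x) <= 2^-1 * rnorm x.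
  rewrite mulrA ler_wpM2r ?rnorm_ge0 // -ler_pdivlMl // (le_trans (ltW bb')) //.
  by rewrite invfM mulrC.
have := ler_wpM2l (ltW K0) h; lra.
Qed.

Lemma line_bound : exists2 K : R, 0 <= K & forall b x, op_dom A x ->
  (1 + `|b|) * rnorm x <= K * rnorm (A x + ((- m) +i* b) *: x).
Proof.
(* For [|b| > r], [sin delta * |b| > m + 1] puts [- m + i b] in the sector, and [r >= 1] gives
   [1 + |b| <= 2 |- m + i b|]. *)
pose r := (m + 1) / sin delta.
have r1 : 1 <= r by rewrite ler_pdivlMr // mul1r (le_trans (sin_le1 _)) // lerDr.
have [K K0 KP] := segment_bound r.
have C2 : 0 <= 2 * C by rewrite mulr_ge0 // ltW.
have rK : 0 <= (1 + r) * K by rewrite mulr_ge0 ?(ltW K0) //; lra.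
exists ((1 + r) * K + 2 * C); first by rewrite addr_ge0.
move=> b x Dx; set w := rnorm (_ + _); have w0 : 0 <= w by exact: rnorm_ge0.
have x0 := rnorm_ge0 x; rewrite [leRHS]mulrDl.
have [br|br] := leP `|b| r.
  have := KP b x br Dx; rewrite -/w => h.
  rewrite (le_trans (y := (1 + r) * K * w)) //; last by rewrite lerDl mulr_ge0.
  by rewrite -mulrA ler_pM // lerD2l.
have bz := Im_le_cabs ((- m) +i* b); rewrite /= in bz.
have zd : - (sin delta * cabs ((- m) +i* b)) < complex.Re ((- m) +i* b).
  rewrite /= ltrN2 (lt_le_trans (y := sin delta * r)) //.
    by rewrite mulrC divfK ?gt_eqF // ltrDl.
  by rewrite ler_pM2l // (le_trans (ltW br)).
have := sectorial_bound zd Dx; rewrite -/w => h.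
rewrite (le_trans (y := 2 * C * w)) //; last by rewrite lerDr mulr_ge0.
rewrite -mulrA (le_trans _ (ler_wpM2l _ h)) // mulrA ler_wpM2r //; lra.
Qed.

(** For [z = a + i b] put [w = (A - m + i b) x]. Since [Re (w|x) >= 0], the norm of [w + a x]
    dominates both [|w|], which controls [(1 + |b|) |x|] by [line_bound], and [a |x|]. *)
Lemma half_plane_bound : exists2 K : R, 0 <= K & forall (z : R[i]) x,
  0 <= complex.Re z -> op_dom A x ->
  cabs (z + 1) * rnorm x <= K * rnorm (shift_operator A m x + z *: x).
Proof.
have [K K0 KP] := line_bound; exists (K + 1); first by rewrite addr_ge0.
move=> [a b] x /= a0 Dx; have := KP b x Dx; set w := A x + _ => h.
have -> : A x - m%:C *: x + (a +i* b) *: x = w + a%:C *: x.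
  rewrite /w -!addrA; congr (_ + _); rewrite -scaleNr -!scalerDl; congr (_ *: _).
  by apply/eqP; rewrite eq_complex /= ?oppr0 !add0r addr0 !eqxx.
have wx : 0 <= rip ip w x.
  have -> : w = A x - m%:C *: x + (0 +i* b) *: x.
    rewrite /w -!addrA; congr (_ + _); rewrite -scaleNr -!scalerDl; congr (_ *: _).
    by apply/eqP; rewrite eq_complex /= ?oppr0 !add0r addr0 !eqxx.
  rewrite !(ripDl, ripNl, ripZl) (rip_sqr ipn).
  have -> : rip ip ((0 +i* b) *: x) x = 0.
    rewrite /rip linearZl_LR /= ipn normHE -rmorphXn.
    by rewrite /= mul0r mulr0 subr0.
  by rewrite addr0 subr_ge0; exact: mA.
have sq : rnorm (w + a%:C *: x) ^+ 2 =
    rnorm w ^+ 2 + 2 * a * rip ip w x + (a * rnorm x) ^+ 2.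
  by rewrite (rnormD_sqr ipn) ripZr rnormZ cabs_real ger0_norm // mulrA.
have ax : 0 <= a * rnorm x by rewrite mulr_ge0 ?rnorm_ge0.
have awx : 0 <= 2 * a * rip ip w x by rewrite !mulr_ge0.
have w1 : rnorm w <= rnorm (w + a%:C *: x).
  rewrite -(ler_pXn2r (n := 2)) ?nnegrE ?rnorm_ge0 // sq -addrA lerDl.
  by rewrite addr_ge0 ?sqr_ge0.
have w2 : a * rnorm x <= rnorm (w + a%:C *: x).
  rewrite -(ler_pXn2r (n := 2)) ?nnegrE ?rnorm_ge0 // sq lerDr.
  by rewrite addr_ge0 ?sqr_ge0.
have z1 : cabs ((a +i* b) + 1) <= 1 + `|b| + a.
  rewrite (le_trans (cabs_le _)) //= addr0 ger0_norm ?addr_ge0 //; lra.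
rewrite (le_trans (ler_wpM2r (rnorm_ge0 _) z1)) // mulrDl [leRHS]mulrDl mul1r.
by rewrite lerD // (le_trans h) // ler_wpM2l.
Qed.

End Spectrum.

(** * Equality of the lower bound and the spectral abscissa *)

Theorem proposition2p2 (R : realType) (H : completeNormedModType R[i])
    (ip : {dot H for @Num.conj R[i]}) (A : operator H)
    (S : R -> {linear H -> H}) :
  induces_norm ip ->
  (exists x : H, x != 0) ->
  accretive ip A ->
  generates_bounded_holomorphic A S ->
  (forall u0 : H, u0 != 0 -> log_convex (fun t : R => rnorm (S t u0))) ->
  (forall u0 : H, op_dom A u0 -> `|u0| = 1 ->
    (rnorm (S t u0) - rnorm (S 0 u0)) / t @[t --> 0^'+]
      --> - complex.Re (ip (A u0) u0)) ->
  [/\ strictly_accretive ip A,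
      lower_bound ip A = spectral_abscissa A &
      (0 < spectral_abscissa A)%E].
Proof.
move=> ipn [x0 x0N0] acc [[denseA _ [delta [C [d0 d2 C0 sectA]]]] S0 SA] Slc Sder.
have s_gt0 := spectral_abscissa_gt0 d0 d2 sectA.
have unit x : op_dom A x -> x != 0 -> op_dom A (((rnorm x)^-1)%:C *: x) /\
    `|((rnorm x)^-1)%:C *: x| = 1.
  move=> Dx xN0; split; first exact: op_domZ.
  have px : 0 < rnorm x by rewrite rnorm_gt0.
  by rewrite normHE rnormZ cabs_real gtr0_norm ?invr_gt0 // mulVf ?gt_eqF.
have lb_le x : op_dom A x -> x != 0 ->
    (lower_bound ip A <= (rip ip (A x) x / rnorm x ^+ 2)%:E)%E.
  move=> Dx xN0; have [Du Nu] := unit x Dx xN0.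
  have px : 0 < rnorm x by rewrite rnorm_gt0.
  apply: ereal_inf_lbound; set u := _ *: x in Du Nu.
  exists (ip (A u) u); first by exists u.
  congr EFin; rewrite -/(rip ip (A u) u) /u opZ // ripZl ripZr; field.
  by rewrite gt_eqF.
(* Density of the domain in [H != 0] provides [e]; its Rayleigh quotient keeps [m(A)] from being
   [+oo]. *)
have [e [De eN0]] : exists e, op_dom A e /\ e != 0.
  have [||e [e0 De]] := denseA (~` [set 0]).
  - by exists x0; exact/eqP.
  - apply: closed_openC; apply: accessible_closed_set1.
    exact/hausdorff_accessible/norm_hausdorff.
  - by exists e; split=> //; exact/eqP.
have [m mE] : exists m : R, lower_bound ip A = m%:E.
  have := lb_le e De eN0; move: acc; rewrite /accretive.
  by case: (lower_bound ip A) => // m; exists m.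
have m0 : 0 <= m by rewrite -lee_fin -mE.
have mA x : op_dom A x -> m * rnorm x ^+ 2 <= rip ip (A x) x.
  move=> Dx; have [->|xN0] := eqVneq x 0.
    by rewrite rnorm0 op0 rip0l expr0n mulr0.
  have px : 0 < rnorm x by rewrite rnorm_gt0.
  by have := lb_le x Dx xN0; rewrite mE lee_fin ler_pdivlMr // exprn_gt0.
have ms := le_spectral_abscissa ipn d0 d2 sectA m0 mA.
suff mse : m%:E = spectral_abscissa A.
  by split=> //; rewrite /strictly_accretive mE mse.
apply/eqP; rewrite eq_le ms leNgt; apply/negP => m_lt; exfalso.
have [K K0 KP] := half_plane_bound ipn d0 d2 C0 sectA m0 mA m_lt.
pose B := shift_operator A m.
have accB x : op_dom B x -> 0 <= rip ip (B x) x.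
  by move=> Dx; rewrite /= ripDl ripNl ripZl (rip_sqr ipn) subr_ge0; exact: mA.
pose D := 4 * (1 + 32 * K ^+ 2).
have D0 : 0 < D by rewrite mulr_gt0 // ltr_wpDr // mulr_ge0 ?sqr_ge0.
have coer x : op_dom A x -> rnorm x ^+ 2 <= D * rip ip (B x) x.
  have m1 : 0 < (m + 1)^-1 by rewrite invr_gt0 ltr_wpDl.
  apply: (accretive_coercive ipn accB K0 KP m1) => s sp sm.
  have l0 : 0 < s^-1 - m.
    rewrite subr_gt0 (lt_trans (y := m + 1)) ?ltrDl //.
    by rewrite -[ltLHS]invrK ltf_pV2 // posrE.
  have [T [_ TP _]] : exists T : {linear H -> H}, is_resolvent A (s^-1 - m)%:C T.
    by apply: (half_plane_resolvent ipn d0 d2 sectA m0 mA); rewrite /=; lra.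
  (* [I + s B = s (A + (s^-1 - m))], so [V = (I + s B)^-1]; the threshold [1 / (m + 1)] keeps
     [s^-1 - m] positive. *)
  pose V : {linear H -> H} := GRing.scale_fun (s^-1)%:C T.
  have VP y : op_dom A (V y) /\ V y + s%:C *: B (V y) = y.
    have [DT TE] := TP y; split; first exact: op_domZ.
    have ss : s%:C * (s^-1)%:C = 1 :> R[i] by rewrite -rmorphM divff ?gt_eqF.
    rewrite -[RHS]TE /V /B /= opZ // scalerBr !scalerA ss mulrAC ss mul1r scale1r.
    by rewrite addrCA -scalerBl -rmorphB.
  exists V; split=> //.
  exact: (@euler_step_decr _ _ ip A S ipn S0 SA Slc Sder m s V mA sp VP).
(* On unit vectors coercivity of [B] reads [Re (Au|u) >= m + 1 / D], which exceeds the infimum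
   [m]. *)
have : ((m + D^-1)%:E <= lower_bound ip A)%E.
  apply: le_ereal_inf_tmp => _ [_ [u [Du Nu] <-] <-]; rewrite lee_fin.
  have Nu1 : rnorm u = 1 by rewrite /rnorm Nu.
  have := coer u Du; rewrite /B /= ripDl ripNl ripZl (rip_sqr ipn) Nu1 expr1n mulr1.
  by rewrite -ler_pdivrMl // mulr1 /rip; lra.
by rewrite mE lee_fin gerDl leNgt invr_gt0 D0.
Qed.
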